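(* Let $\Omega\subset\widehat\Omega$ be finite sets. Let $K$ be a $\frac12$-lazy, ergodic, irreducible, reversible Markov kernel on $\widehat\Omega$ with stationary distribution $\mu$ and spectral profile $\widehat\Lambda$, and let $Q$ be a $\frac12$-lazy, ergodic, irreducible, reversible Markov kernel on $\Omega$ with stationary distribution $\nu$ and spectral profile $\Lambda$. Let $M$ be a matrix with nonnegative entries such that $Mf\in\mathbb{R}^{\widehat\Omega}$ is an extension of $f$ (i.e. $(Mf)(x)=f(x)$ for $x\in\Omega$) for all $f\in\mathbb{R}^\Omega$. Assume that for some $\mathcal{A}>0$, $$\mathcal{E}_Q(f,f)\ge\mathcal{A}\,\mathcal{E}_K(Mf,Mf)\quad\text{for all }f\in\mathbb{R}^\Omega.$$ Set $C_1=\sup_{x\in\Omega}\frac{\nu(x)}{\mu(x)}$. For $S\subset\Omega$ let $\widehat S\subset\widehat\Omega$ be the support of $M\mathbf{1}_S$, and set $C_2=\sup_{\emptyset\ne S\subset\Omega}\frac{\mu(\widehat S)}{\nu(S)}$. Then for all $r\ge\min_{\omega\in\Omega}\nu(\omega)$, $$\Lambda(r)\ge\frac{\mathcal{A}}{C_1}\,\widehat\Lambda(C_2r).$$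
   Context: For a kernel $P$ on a finite set $X$ with stationary distribution $\pi$: $\mathcal{E}_P(f,f)=\frac12\sum_{x,y\in X}|f(x)-f(y)|^2P(x,y)\pi(x)$ and $V_\pi(f)=\frac12\sum_{x,y\in X}|f(x)-f(y)|^2\pi(x)\pi(y)$. For $S\subset X$ let $c_0(S)=\{f:X\to\mathbb{R}: f\ge0,\ \mathrm{supp}(f)\subset S,\ f\text{ not constant}\}$ and $\lambda(S)=\inf_{f\in c_0(S)}\frac{\mathcal{E}_P(f,f)}{V_\pi(f)}$. With $\pi_{\min}=\min_{x\in X}\pi(x)$, the spectral profile of $P$ is $\Lambda(r)=\inf\{\lambda(S):S\subset X,\ \pi_{\min}\le\pi(S)\le r\}$, for $r\ge\pi_{\min}$. A kernel $P$ is $\frac12$-lazy if $P(x,x)\ge\frac12$ for all $x$. $\mathbf{1}_S$ is the indicator function of $S$. *)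

(* Defs.v *)
(* A kernel on a finite set X is a function X -> X -> R. *)
From mathcomp Require Import all_boot all_order all_algebra.
From mathcomp Require Import all_classical all_reals ereal.
Set Implicit Arguments.
Unset Strict Implicit.
Unset Printing Implicit Defensive.
Import Order.TTheory GRing.Theory Num.Theory.
Local Open Scope classical_set_scope.
Local Open Scope ring_scope.

Section Kernels.
Context {R : realType} {X : finType}.
Implicit Types (P : X -> X -> R) (pi f : X -> R) (S : {set X}).

Definition markov_kernel P : Prop :=
  (forall x y, 0 <= P x y) /\ (forall x, \sum_y P x y = 1).

Fixpoint kernel_pow P (n : nat) : X -> X -> R :=
  match n with
  | 0 => fun x y => (x == y)%:R
  | n'.+1 => fun x y => \sum_z P x z * kernel_pow P n' z y
  end.

Definition irreducible_kernel P : Prop :=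
  forall x y, exists n, 0 < kernel_pow P n x y.

(* For every x, the return times to x have greatest common divisor 1. *)
Definition aperiodic_kernel P : Prop :=
  forall x d, (forall n, (0 < n)%N -> 0 < kernel_pow P n x x -> (d %| n)%N) ->
    d = 1%N.

Definition ergodic_kernel P : Prop :=
  irreducible_kernel P /\ aperiodic_kernel P.

Definition half_lazy P : Prop := forall x, 1 / 2 <= P x x.

Definition stationary_distribution P pi : Prop :=
  [/\ forall x, 0 <= pi x,
      \sum_x pi x = 1
    & forall y, \sum_x pi x * P x y = pi y].

Definition reversible_kernel P pi : Prop :=
  forall x y, pi x * P x y = pi y * P y x.

Definition mass pi S : R := \sum_(x in S) pi x.

Definition dirichlet_form P pi f : R :=
  1 / 2 * \sum_x \sum_y `|f x - f y| ^+ 2 * P x y * pi x.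

Definition variance_form pi f : R :=
  1 / 2 * \sum_x \sum_y `|f x - f y| ^+ 2 * pi x * pi y.

Definition c0 S : set (X -> R) :=
  [set f | [/\ forall x, 0 <= f x,
               {subset support f <= S}
             & ~ (exists c : R, forall x, f x = c)]].

(* The infima defining lambda and the spectral profile are taken in \bar R:
   c0 S is empty when X is a single point, and the infimum is then +oo. *)
Definition lambda P pi S : \bar R :=
  ereal_inf [set (dirichlet_form P pi f / variance_form pi f)%:E | f in c0 S].

(* A minimum whenever X is nonempty, as X is finite. *)
Definition pi_min pi : R := inf (range pi).

(* Meant for r >= pi_min pi; below that value no S qualifies. *)
Definition spectral_profile P pi (r : R) : \bar R :=
  ereal_inf [set lambda P pi S | S in
    [set S : {set X} | pi_min pi <= mass pi S <= r]].

Definition indicator S : X -> R := fun x => (x \in S)%:R.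

End Kernels.

Definition mat_app {R : realType} {X Y : finType} (M : Y -> X -> R)
  (f : X -> R) : Y -> R := fun y => \sum_x M y x * f x.

Definition hat_set {R : realType} {X Y : finType} (M : Y -> X -> R)
  (S : {set X}) : {set Y} := finset (support (mat_app M (indicator S))).

(* Main.v *)
(** The extension [g := M f] of a test function [f] for [S] is a test function for
    the support of [M 1_S]. It multiplies the Dirichlet form by at most [1 / A].
    Since the variance is the least mean square distance to a constant, comparing
    [f] with the [mu]-mean of [g] gives [V_nu f <= C1 V_mu g]. *)
Require Import Defs.
From mathcomp Require Import all_boot all_order all_algebra.
From mathcomp Require Import all_classical all_reals ereal.
From mathcomp Require Import ring.
Import Order.TTheory GRing.Theory Num.Theory.
Local Open Scope classical_set_scope.
Local Open Scope ring_scope.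

Section Kernels.
Set Implicit Arguments.
Unset Strict Implicit.
Context {R : realType} {X : finType}.
Implicit Types (P : X -> X -> R) (pi f : X -> R) (S : {set X}).

(** A real [sup] is an upper bound only for nonempty sets that are bounded above. Here the sum of
    all [|F y|] is a bound, by finiteness of [X]. This makes [C1] and [C2] genuine bounds. *)
Lemma fin_image_le_sup (F : X -> R) (D : set X) x :
  D x -> F x <= sup [set F y | y in D].
Proof.
move=> Dx; apply: sup_upper_bound; last by exists x.
split; first by exists (F x), x.
exists (\sum_y `|F y|) => _ [y _ <-].
by rewrite (bigD1 y) //= (le_trans (ler_norm _)) // lerDl sumr_ge0.
Qed.

Lemma stationary_pow P pi n y : stationary_distribution P pi ->
  \sum_x pi x * kernel_pow P n x y = pi y.
Proof.
move=> [_ _ stat]; elim: n y => [|n IHn] y /=.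
  rewrite (bigD1 y) //= eqxx mulr1 big1 ?addr0 // => x /negPf ->.
  by rewrite mulr0.
under eq_bigr do rewrite mulr_sumr.
rewrite exchange_big /= -[RHS]IHn; apply: eq_bigr => z _.
by rewrite -[pi z]stat mulr_suml; apply: eq_bigr => x _; rewrite mulrA.
Qed.

Lemma kernel_pow_ge0 P n x y : markov_kernel P -> 0 <= kernel_pow P n x y.
Proof.
move=> [P_ge0 _]; elim: n x y => [|n IHn] x y /=; first exact: ler0n.
by apply: sumr_ge0 => z _; rewrite mulr_ge0.
Qed.

(** Total mass 1 gives some [z] with [pi z > 0]. Irreducibility carries this mass to [x] in [n]
    steps, and [pi] is invariant under the [n]-step kernel. *)
Lemma stationary_gt0 P pi x : markov_kernel P -> irreducible_kernel P ->
  stationary_distribution P pi -> 0 < pi x.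
Proof.
move=> P_markov P_irr pi_stat; have [pi_ge0 pi_sum1 _] := pi_stat.
have [z pi_z_gt0] : exists z, 0 < pi z.
  apply/existsP; apply: contraT => /existsPn pi_le0.
  move: pi_sum1; rewrite big1 => [/eqP|z _]; first by rewrite eq_sym oner_eq0.
  by apply/eqP; rewrite eq_le pi_ge0 andbT leNgt pi_le0.
have [n Pn_gt0] := P_irr z x.
rewrite -(stationary_pow n x pi_stat) (bigD1 z) //=.
rewrite ltr_pwDl ?mulr_gt0 //.
by apply: sumr_ge0 => w _; rewrite mulr_ge0 // kernel_pow_ge0.
Qed.

(** Differences of [f] do not change under the shift [h = f - c]. The centre stays free so that one
    [c] can serve two measures: any centre bounds the variance from above, and the mean gives
    equality. *)
Lemma variance_formE pi f c : \sum_x pi x = 1 ->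
  variance_form pi f =
    \sum_x (f x - c) ^+ 2 * pi x - (\sum_x f x * pi x - c) ^+ 2.
Proof.
move=> pi_sum1; pose h x := f x - c.
have -> : \sum_x f x * pi x - c = \sum_x h x * pi x.
  under [RHS]eq_bigr do rewrite mulrBl.
  by rewrite big_split /= sumrN -mulr_sumr pi_sum1 mulr1.
(* Each summand is a factor in [x] times a factor in [y], so the double sums split into products. *)
have sq_diffE x y : `|f x - f y| ^+ 2 * pi x * pi y =
    h x ^+ 2 * pi x * pi y + pi x * (h y ^+ 2 * pi y)
      + (-2 * (h x * pi x)) * (h y * pi y).
  by rewrite real_normK ?num_real // /h; ring.
rewrite /variance_form.
under eq_bigr do under eq_bigr do rewrite sq_diffE.
under eq_bigr do rewrite !big_split /= -!mulr_sumr pi_sum1 mulr1.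
by rewrite !big_split /= -!mulr_suml -mulr_sumr pi_sum1; field.
Qed.

Lemma variance_form_le pi f c : \sum_x pi x = 1 ->
  variance_form pi f <= \sum_x (f x - c) ^+ 2 * pi x.
Proof. by move=> /(variance_formE f c) ->; rewrite gerBl sqr_ge0. Qed.

Lemma variance_form_gt0 pi f : (forall x, 0 < pi x) ->
  ~ (exists c, forall x, f x = c) -> 0 < variance_form pi f.
Proof.
move=> pi_gt0 f_nonconst.
have term_ge0 x y : 0 <= `|f x - f y| ^+ 2 * pi x * pi y.
  by rewrite !mulr_ge0 ?exprn_ge0 ?(ltW (pi_gt0 _)).
have V_ge0 : 0 <= variance_form pi f.
  rewrite mulr_ge0 ?divr_ge0 ?ler01 ?ler0n //.
  by apply: sumr_ge0 => x _; apply: sumr_ge0.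
rewrite lt_neqAle V_ge0 andbT.
apply/eqP => /esym/eqP; rewrite /variance_form mulf_eq0 mul1r invr_eq0 pnatr_eq0 /=.
rewrite psumr_eq0 => [/allP sum0|x _]; last exact: sumr_ge0.
(* All terms of the sum vanish, so [f] agrees everywhere with its value at a base point. On an empty
   [X] any constant will do. *)
apply: f_nonconst; case: (pickP X) => [x0 _|X0]; last by exists 0 => x; have := X0 x.
exists (f x0) => x; apply/eqP; rewrite -subr_eq0 -normr_eq0.
have := sum0 x (mem_index_enum x); rewrite psumr_eq0 //.
move=> /allP /(_ x0 (mem_index_enum x0)).
by rewrite !mulf_eq0 !(gt_eqF (pi_gt0 _)) !orbF orbb.
Qed.

Lemma pi_min_le_mass pi S x : (forall y, 0 <= pi y) -> x \in S ->
  pi_min pi <= mass pi S.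
Proof.
move=> pi_ge0 xS; apply: (@le_trans _ _ (pi x)).
  by apply: ge_inf; [exists 0 => _ [y _ <-]|exists x].
by rewrite /mass (bigD1 x) //= lerDl sumr_ge0.
Qed.

Lemma spectral_profile_le P pi r S f : pi_min pi <= mass pi S <= r ->
  c0 S f ->
  (spectral_profile P pi r <=
    (dirichlet_form P pi f / variance_form pi f)%:E)%E.
Proof.
move=> S_mass fS; apply: (@le_trans _ _ (lambda P pi S)).
  by apply: ereal_inf_lbound; exists S.
by apply: ereal_inf_lbound; exists f.
Qed.

End Kernels.

Section Extension.
Set Implicit Arguments.
Unset Strict Implicit.
Context {R : realType} {Y : finType} {D : {set Y}}.
Notation X := {x : Y | x \in D}.
Context {M : Y -> X -> R}.
Hypothesis M_ge0 : forall y x, 0 <= M y x.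
Hypothesis M_extension :
  forall (f : X -> R) (x : X), mat_app M f (\val x) = f x.

Lemma val_hat_set (S : {set X}) x : x \in S -> \val x \in hat_set M S.
Proof.
by move=> xS; rewrite inE /= M_extension /indicator xS oner_eq0.
Qed.

(** If [M 1_S] vanishes at [y], nonnegativity of the entries forces [M y x = 0] for every [x] in
    [S], hence [M f] vanishes at [y] too. It is not constant because it restricts to [f]. *)
Lemma mat_app_c0 (S : {set X}) f : c0 S f -> c0 (hat_set M S) (mat_app M f).
Proof.
move=> [f_ge0 f_supp f_nonconst]; split.
- by move=> y; apply: sumr_ge0 => x _; rewrite mulr_ge0.
- move=> y; rewrite !inE; apply: contra => /eqP MS0.
  apply/eqP/big1 => x _.
  have [->|fx_neq0] := eqVneq (f x) 0; first exact: mulr0.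
  move/eqP: MS0; rewrite psumr_eq0 => [/allP|z _]; last first.
    by rewrite mulr_ge0 ?ler0n.
  move=> /(_ x (mem_index_enum x)).
  by rewrite /indicator f_supp //= mulr1 => /eqP ->; rewrite mul0r.
- move=> [c Mf_const]; apply: f_nonconst; exists c => x.
  by rewrite -M_extension.
Qed.

Lemma variance_form_extension_le (mu g : Y -> R) (nu : X -> R) C :
  (forall y, 0 <= mu y) -> \sum_y mu y = 1 -> \sum_x nu x = 1 -> 0 <= C ->
  (forall x, nu x <= C * mu (\val x)) ->
  variance_form nu (g \o \val) <= C * variance_form mu g.
Proof.
move=> mu_ge0 mu_sum1 nu_sum1 C_ge0 nu_le.
set c := \sum_y g y * mu y.
apply: le_trans (variance_form_le _ c nu_sum1) _.
(* As [c] is the [mu]-mean of [g], the correction term is zero. What remains is a pointwise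
   comparison on [D]; points outside [D] only add to the right side. *)
rewrite (variance_formE g c mu_sum1) subrr expr0n subr0 mulr_sumr.
apply: (@le_trans _ _ (\sum_(x : X) C * ((g (\val x) - c) ^+ 2 * mu (\val x)))).
  by apply: ler_sum => x _; rewrite mulrCA ler_wpM2l ?sqr_ge0.
rewrite -(big_sub [in D] (fun y => C * ((g y - c) ^+ 2 * mu y))) /=.
rewrite [leRHS](bigID [in D]) /= lerDl.
by apply: sumr_ge0 => y _; rewrite mulr_ge0 // mulr_ge0 ?sqr_ge0.
Qed.

End Extension.

Theorem lemma14 (R : realType) (Omhat : finType) (Om : {set Omhat})
  (K : Omhat -> Omhat -> R) (mu : Omhat -> R)
  (Q : {x : Omhat | x \in Om} -> {x : Omhat | x \in Om} -> R)
  (nu : {x : Omhat | x \in Om} -> R)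
  (M : Omhat -> {x : Omhat | x \in Om} -> R) (A : R)
  (K_markov : markov_kernel K) (K_lazy : half_lazy K)
  (K_ergodic : ergodic_kernel K) (K_irreducible : irreducible_kernel K)
  (mu_stationary : stationary_distribution K mu)
  (K_reversible : reversible_kernel K mu)
  (Q_markov : markov_kernel Q) (Q_lazy : half_lazy Q)
  (Q_ergodic : ergodic_kernel Q) (Q_irreducible : irreducible_kernel Q)
  (nu_stationary : stationary_distribution Q nu)
  (Q_reversible : reversible_kernel Q nu)
  (M_ge0 : forall x y, 0 <= M x y)
  (M_extension : forall (f : {x : Omhat | x \in Om} -> R)
     (x : {x : Omhat | x \in Om}), mat_app M f (\val x) = f x)
  (A_gt0 : 0 < A)
  (Q_ge_K : forall f : {x : Omhat | x \in Om} -> R,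
     A * dirichlet_form K mu (mat_app M f) <= dirichlet_form Q nu f) :
  let C1 := sup [set nu x / mu (\val x) | x in setT] in
  let C2 := sup [set mass mu (hat_set M S) / mass nu S | S in
    [set S : {set {x : Omhat | x \in Om}} | S != finset.set0]] in
  forall r : R, pi_min nu <= r ->
    ((A / C1)%:E * spectral_profile K mu (C2 * r) <= spectral_profile Q nu r)%E.
Proof.
move=> C1 C2 r _.
have [mu_ge0 mu_sum1 _] := mu_stationary.
have [_ nu_sum1 _] := nu_stationary.
have mu_gt0 y := stationary_gt0 y K_markov K_irreducible mu_stationary.
have nu_gt0 x := stationary_gt0 x Q_markov Q_irreducible nu_stationary.
have nu_le_C1 x : nu x <= C1 * mu (\val x).
  rewrite -ler_pdivrMr //.
  exact: (fin_image_le_sup (fun x => nu x / mu (\val x))).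
(* The left side is shown to be a lower bound for every admissible [S] and every test function [f],
   so no infimum has to be attained. *)
apply: le_ereal_inf_tmp => _ [S /andP[_ S_le_r] <-].
apply: le_ereal_inf_tmp => _ [f fS <-].
have [_ f_supp f_nonconst] := fS.
(* A function supported in the empty set is constantly [0]. *)
have [x xS] : exists x, x \in S.
  apply/set0Pn/eqP => S0; apply: f_nonconst; exists 0 => x; apply/eqP.
  by apply: contraT => /f_supp; rewrite S0 inE.
have C1_gt0 : 0 < C1.
  by rewrite -(pmulr_lgt0 _ (mu_gt0 (\val x))) (lt_le_trans (nu_gt0 x)).
have S_gt0 : 0 < mass nu S.
  by rewrite /mass (bigD1 x) //= ltr_pwDl // sumr_ge0 // => z _; exact: ltW.
have Shat_le : mass mu (hat_set M S) / mass nu S <= C2.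
  apply: (fin_image_le_sup (fun S => mass mu (hat_set M S) / mass nu S)) => /=.
  by apply/set0Pn; exists x.
have Shat_mass : pi_min mu <= mass mu (hat_set M S) <= C2 * r.
  rewrite (pi_min_le_mass mu_ge0 (val_hat_set M_extension xS)) /=.
  apply: (@le_trans _ _ (C2 * mass nu S)); first by rewrite -ler_pdivrMr.
  (* Passing from [mass nu S] to [r] needs [0 <= C2], which holds because [C2] dominates a ratio of
     masses. *)
  apply: ler_wpM2l S_le_r; apply: le_trans Shat_le.
  by rewrite divr_ge0 ?(ltW S_gt0) // sumr_ge0.
have gS := mat_app_c0 M_ge0 M_extension fS.
apply: (@le_trans _ _ ((A / C1)%:E *
    (dirichlet_form K mu (mat_app M f) / variance_form mu (mat_app M f))%:E)%E).
  apply: lee_wpmul2l; first by rewrite lee_fin divr_ge0 ?ltW.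
  exact: spectral_profile_le Shat_mass gS.
have Vf_gt0 := variance_form_gt0 nu_gt0 f_nonconst.
have [_ _ /(variance_form_gt0 mu_gt0) Vg_gt0] := gS.
have Vf_le : variance_form nu f <= C1 * variance_form mu (mat_app M f).
  have Mf_val : mat_app M f \o \val = f by exact/funext/M_extension.
  rewrite -[X in variance_form nu X]Mf_val.
  exact: variance_form_extension_le (ltW C1_gt0) nu_le_C1.
rewrite -EFinM lee_fin mulf_div.
have Kg_ge0 : 0 <= A * dirichlet_form K mu (mat_app M f).
  rewrite mulr_ge0 ?(ltW A_gt0) // mulr_ge0 ?divr_ge0 ?ler01 ?ler0n //.
  apply: sumr_ge0 => y _; apply: sumr_ge0 => z _.
  by rewrite !mulr_ge0 ?exprn_ge0 //; case: K_markov.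
have C1Vg_gt0 := mulr_gt0 C1_gt0 Vg_gt0.
(* Numerators compare by [Q_ge_K], and inverting [Vf_le] compares the denominators. *)
by apply: ler_pM; rewrite ?invr_ge0 ?lef_pV2 ?posrE ?(ltW C1Vg_gt0).
Qed.
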